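(* Let $G$ be a finite group and let $\mathcal I\subset\mathcal J$ be disk-like $G$-indexing systems. The adjoint pair of functors $$\mathbb P_{\mathcal I}^{\mathcal J}\colon\Gamma_{\mathcal I}[G\underline{\mathrm{Top}}_*]\rightleftarrows\Gamma_{\mathcal J}[G\underline{\mathrm{Top}}_*]\colon\mathbb U_{\mathcal I}^{\mathcal J}$$ specifies an equivalence of categories.
   Context: Spaces are compactly generated weak Hausdorff. $G\mathrm{Top}_*$ is the category of based left $G$-spaces and based $G$-maps; $G\underline{\mathrm{Top}}_*$ is the self-enriched version with mapping $G$-spaces $F(X,Y)$ of all based maps with conjugation action. A $G\mathrm{Top}_*$-functor is a functor enriched over $(G\mathrm{Top}_*,\wedge)$. A $G$-indexing system $\mathcal I$ assigns to each subgroup $H\subset G$ a class $\mathcal I(H)$ of finite $H$-sets containing all finite trivial $H$-sets, closed under isomorphism, subobjects, finite coproducts, restriction, conjugation and self-induction ($T\in\mathcal I(K)$, $H/K\in\mathcal I(H)$ imply $H\times_KT\in\mathcal I(H)$). A transfer system is a partial order on the subgroups of $G$ refining inclusion and closed under conjugation and restriction ($K\to H$, $L\subset H\Rightarrow K\cap L\to L$). $\mathcal I$ is disk-like if the transfer system $K\to H\Leftrightarrow H/K\in\mathcal I(H)$ is generated by relations of the form $K\to G$. For $\alpha\colon G\to\Sigma_n$, $\mathbf n^\alpha$ is $\{1,\dots,n\}$ with $G$-action through $\alpha$, $\mathbf n^\alpha_+$ has an added base point $0$, and $\mathbf n_+$ has trivial action. $\Gamma_{\mathcal I}$ is the full subcategory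 of $G\underline{\mathrm{Top}}_*$ on the $\mathbf n^\alpha_+$ with $\mathbf n^\alpha\in\mathcal I(G)$; $\Gamma$ is the full subcategory on the $\mathbf n_+$. A $\Gamma_{\mathcal I}$-$G$-space is a $G\mathrm{Top}_*$-functor $X\colon\Gamma_{\mathcal I}\to G\underline{\mathrm{Top}}_*$ such that for each injection $\phi\colon\mathbf m_+\to\mathbf n_+$ in $\Gamma$ the induced map is a $(G\times\Sigma_\phi)$-cofibration, $\Sigma_\phi\subset\Sigma_n$ being the permutations preserving $\operatorname{im}\phi$. With $G\mathrm{Top}_*$-natural transformations these form the category $\Gamma_{\mathcal I}[G\underline{\mathrm{Top}}_*]$. For $\mathcal I\subset\mathcal J$, $\mathbb U_{\mathcal I}^{\mathcal J}$ is restriction along the inclusion $\Gamma_{\mathcal I}\to\Gamma_{\mathcal J}$ and $\mathbb P_{\mathcal I}^{\mathcal J}$ is its left adjoint, the enriched left Kan extension $\mathbb P_{\mathcal I}^{\mathcal J}X(T_+)=\int^{S_+\in\Gamma_{\mathcal I}}\Gamma_{\mathcal J}(S_+,T_+)\wedge X(S_+)$. *)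

(* Defs.v *)
From HB Require Import structures.
From mathcomp Require Import all_boot all_order all_algebra all_fingroup.
From mathcomp Require Import all_classical all_reals all_analysis.
Set Implicit Arguments.
Unset Strict Implicit.
Unset Printing Implicit Defensive.
Import Order.TTheory GRing.Theory Num.Theory.
Import numFieldNormedType.Exports.
Local Open Scope classical_set_scope.
Local Open Scope group_scope.

Definition compact_hausdorff (K : topologicalType) : Prop :=
  compact [set: K] /\ hausdorff_space K.

Definition weak_hausdorff (X : topologicalType) : Prop :=
  forall (K : topologicalType) (u : K -> X),
    compact_hausdorff K -> continuous u -> closed (range u).

Definition compactly_generated (X : topologicalType) : Prop :=
  forall A : set X,
    (forall (K : topologicalType) (u : K -> X),
       compact_hausdorff K -> continuous u -> closed (u @^-1` A)) ->
    closed A.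

Definition cgwh (X : topologicalType) : Prop :=
  compactly_generated X /\ weak_hausdorff X.

(* The k-ification of a space. *)
Definition kify (X : topologicalType) : Type := X.

Section Kify.
Variable X : topologicalType.

Definition kopen : set_system (kify X) := fun U =>
  forall (K : topologicalType) (u : K -> X),
    compact_hausdorff K -> continuous u -> open (u @^-1` U).

Let kopenT : kopen setT.
Proof. by move=> K u _ _; rewrite preimage_setT; exact: openT. Qed.

Let kopenI : setI_closed kopen.
Proof.
by move=> A B oA oB K u hK cu; rewrite preimage_setI; apply: openI;
  [exact: oA|exact: oB].
Qed.

Let kopen_bigU (I : Type) (f : I -> set (kify X)) :
  (forall i, kopen (f i)) -> kopen (\bigcup_i f i).
Proof.
by move=> of_ K u hK cu; rewrite preimage_bigcup; apply: bigcup_open => i _;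
  exact: of_.
Qed.

HB.instance Definition _ := Choice.on (kify X).
HB.instance Definition _ :=
  isOpenTopological.Build (kify X) kopenT kopenI kopen_bigU.
End Kify.

Definition kprod (X Y : topologicalType) : topologicalType := kify (X * Y)%type.

Lemma cgwh_discrete (T : choiceType) : cgwh (discrete_topology T).
Proof. by split=> [A _|K u _ _]; exact: discrete_closed. Qed.

(* As [K] is finite and discrete, an action is continuous as soon as each of
   its elements acts continuously. *)
Record gspace (K : finGroupType) := GSpace {
  gcar :> topologicalType;
  gcar_cgwh : cgwh gcar;
  gact : K -> gcar -> gcar;
  gact1 : forall x, gact 1 x = x;
  gactM : forall g h x, gact (g * h) x = gact g (gact h x);
  gact_continuous : forall g, continuous (gact g)
}.

Definition equivariant (K : finGroupType) (X Y : gspace K) (f : X -> Y) : Prop :=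
  forall g x, f (gact g x) = gact g (f x).

(* Cofibrations are maps with the homotopy extension property in unbased
   K-spaces: for injections from 0_+ this says that X(n_+) is well pointed. *)
Section Cofibration.
Variable R : realType.

Definition unit_interval : topologicalType := set_type (`[0%R, 1%R] : set R).

Lemma mem_unit_interval0 : (0%R : R) \in (`[0%R, 1%R] : set R).
Proof. by rewrite inE /= in_itv /= lexx ler01. Qed.

Definition unit_interval0 : unit_interval := exist _ 0%R mem_unit_interval0.

Definition is_homotopy (K : finGroupType) (X Z : gspace K)
    (h : X * unit_interval -> Z) : Prop :=
  continuous (h : kprod X unit_interval -> Z) /\
  forall g x t, h (gact g x, t) = gact g (h (x, t)).

Definition cofibration (K : finGroupType) (A X : gspace K) (i : A -> X) : Prop :=
  [/\ continuous i, equivariant i &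
   forall (Z : gspace K) (f : X -> Z) (h : A * unit_interval -> Z),
     continuous f -> equivariant f -> is_homotopy h ->
     (forall a, h (a, unit_interval0) = f (i a)) ->
     exists H : X * unit_interval -> Z,
       [/\ is_homotopy H,
           forall x, H (x, unit_interval0) = f x &
           forall a t, H (i a, t) = h (a, t)]].

End Cofibration.

Record bgspace (K : finGroupType) := BGSpace {
  bgcar :> gspace K;
  gbase : bgcar;
  gact_base : forall g, gact g gbase = gbase
}.
Arguments gbase {K} b.

(* Based maps, not necessarily equivariant: the points of F(X, Y). *)
Record bmap (K : finGroupType) (X Y : bgspace K) := BMap {
  bfun :> X -> Y;
  bfun_continuous : continuous bfun;
  bfun_base : bfun (gbase X) = gbase Y
}.

Section BMaps.
Variable K : finGroupType.
Implicit Types X Y Z : bgspace K.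

Lemma bmap_eq X Y (f g : bmap X Y) : (forall x, f x = g x) -> f = g.
Proof.
case: f g => [f cf bf] [g cg bg] /= /funext fg; subst g.
by rewrite (Prop_irrelevance cf cg) (Prop_irrelevance bf bg).
Qed.

Definition bid X : bmap X X :=
  @BMap K X X id (fun x => cvg_id) erefl.

Definition bcomp X Y Z (g : bmap Y Z) (f : bmap X Y) : bmap X Z.
Proof.
refine (@BMap K X Z (g \o f) _ _).
- by move=> x; apply: continuous_comp; exact: bfun_continuous.
- by rewrite /= !bfun_base.
Defined.

Definition bzero X Y : bmap X Y :=
  @BMap K X Y (fun=> gbase Y) (fun x => @cvg_cst _ _ _ _ _) erefl.

Definition bconj X Y (g : K) (f : bmap X Y) : bmap X Y.
Proof.
refine (@BMap K X Y (fun x => gact g (f (gact g^-1 x))) _ _).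
- move=> x; apply: (@continuous_comp _ _ _ (gact g^-1) (gact g \o f)).
    exact: gact_continuous.
  by apply: continuous_comp; [exact: bfun_continuous|exact: gact_continuous].
- by rewrite gact_base bfun_base gact_base.
Defined.

(* In a weak Hausdorff space quasi-compact subspaces may fail to be images of
   compact Hausdorff spaces, hence the test maps in place of the library's
   [compact_open]. *)
Definition bmap_co X Y : Type := bmap X Y.

HB.instance Definition _ X Y := gen_eqMixin (bmap_co X Y).
HB.instance Definition _ X Y := gen_choiceMixin (bmap_co X Y).

Definition bmap_subbase X Y : set (set (bmap_co X Y)) := fun W =>
  exists (C : topologicalType) (u : C -> X) (U : set Y),
    [/\ compact_hausdorff C, continuous u, open U &
        W = [set f : bmap X Y | forall c, U (f (u c))]].

HB.instance Definition _ X Y :=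
  isSubBaseTopological.Build (bmap_co X Y) (@bmap_subbase X Y) id.

(* The mapping space F(X, Y); its G-action is [bconj], its base point [bzero]. *)
Definition mapsp X Y : topologicalType := kify (bmap_co X Y).

End BMaps.

(* The values of [hact] outside [H] are irrelevant. *)
Record hset (gT : finGroupType) (H : {group gT}) := HSet {
  hcar :> finType;
  hact : gT -> hcar -> hcar;
  hact1 : forall x, hact 1 x = x;
  hactM : forall g h x, g \in H -> h \in H ->
    hact (g * h) x = hact g (hact h x)
}.

Section HSets.
Variable gT : finGroupType.
Implicit Types H K L : {group gT}.

Definition hequivariant H (S T : hset H) (f : S -> T) : Prop :=
  forall h x, h \in H -> f (hact h x) = hact h (f x).

Definition htrivial H (T : hset H) : Prop :=
  forall h (x : T), h \in H -> hact h x = x.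

Definition hset_sum H (S T : hset H) : hset H.
Proof.
refine (@HSet gT H (S + T)%type (fun g x =>
  match x with inl s => inl (hact g s) | inr t => inr (hact g t) end) _ _).
- by case=> x; rewrite hact1.
- by move=> g h [] x gH hH; rewrite hactM.
Defined.

Definition hset_res H K (sKH : K \subset H) (T : hset H) : hset K.
Proof.
refine (@HSet gT K T (@hact _ _ T) (@hact1 _ _ T) _).
by move=> g h x gK hK; apply: (@hactM _ H T); exact: (fintype.subsetP sKH).
Defined.

(* [H :^ a] is [a^-1 H a] and [g ^ a^-1] is [a g a^-1]. *)
Definition hset_conj H (a : gT) (T : hset H) : hset (H :^ a)%G.
Proof.
refine (@HSet gT (H :^ a)%G T (fun g x => hact (g ^ a^-1) x) _ _).
- by move=> x; rewrite conj1g hact1.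
- by move=> g h x; rewrite !mem_conjg => gH hH; rewrite conjMg hactM.
Defined.

(* The H-set of members of [C], a family of sets of points of [E] stable
    under [H], for an action [rho] of [gT] on such sets. *)
Section Family.
Variables (H : {group gT}) (E : finType) (rho : gT -> {set E} -> {set E}).
Variable C : {set {set E}}.
Hypothesis rho1 : forall A, rho 1 A = A.
Hypothesis rhoM : forall g h A, rho (g * h) A = rho g (rho h A).
Hypothesis rhoC : forall g A, g \in H -> A \in C -> rho g A \in C.

Definition hset_family : hset H.
Proof.
refine (@HSet gT H {A : {set E} | A \in C}
  (fun g A => insubd A (rho g (val A))) _ _).
- by move=> A; apply: val_inj; rewrite val_insubd rho1 (valP A).
- move=> g h A gH hH; apply: val_inj.
  have hA : rho h (val A) \in C by apply: rhoC => //; exact: (valP A).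
  by rewrite !val_insubd rhoM hA !(rhoC gH hA).
Defined.
End Family.

Section Cosets.
Variables H K : {group gT}.

Let rho (g : gT) (A : {set gT}) : {set gT} := lcoset A g.

Let rho1 A : rho 1 A = A.
Proof. by rewrite /rho lcosetE mul1g. Qed.

Let rhoM g h A : rho (g * h) A = rho g (rho h A).
Proof. by rewrite /rho !lcosetE lcosetM. Qed.

Let rhoC g A : g \in H -> A \in lcosets K H -> rho g A \in lcosets K H.
Proof.
move=> gH /lcosetsP[h hH ->]; apply/lcosetsP; exists (g * h).
  by rewrite groupM.
by rewrite /rho lcosetE lcosetM.
Qed.

Definition hset_cosets : hset H := hset_family rho1 rhoM rhoC.
End Cosets.

(* The induced H-set [H x_K T]: the quotient of [H x T] identifying [(h, t)]
    with [(h k^-1, k t)] for [k] in [K]. *)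
Section Induced.
Variables (H K : {group gT}) (T : hset K).

Definition ind_class (p : gT * T) : {set gT * T} :=
  [set (p.1 * k^-1, hact k p.2) | k in K].

Let rho (g : gT) (A : {set gT * T}) : {set gT * T} :=
  [set (g * p.1, p.2) | p in A].

Let C : {set {set gT * T}} :=
  [set ind_class p | p in [set q : gT * T | q.1 \in H]].

Let rho1 A : rho 1 A = A.
Proof.
rewrite /rho -[RHS]imset_id; apply: eq_imset => -[h t] /=.
by rewrite mul1g.
Qed.

Let rhoM g h A : rho (g * h) A = rho g (rho h A).
Proof.
rewrite /rho -imset_comp; apply: eq_imset => -[k t] /=.
by rewrite mulgA.
Qed.

Let rhoC g A : g \in H -> A \in C -> rho g A \in C.
Proof.
move=> gH /imsetP[[h t]]; rewrite inE /= => hH ->.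
apply/imsetP; exists (g * h, t); first by rewrite inE /= groupM.
rewrite /rho /ind_class -imset_comp; apply: eq_imset => k /=.
by rewrite mulgA.
Qed.

Definition hset_ind : hset H := hset_family rho1 rhoM rhoC.
End Induced.

Record indexing_system := IndexingSystem {
  iadm :> forall H, hset H -> Prop;
  iadm_trivial : forall H (T : hset H), htrivial T -> iadm T;
  iadm_iso : forall H (S T : hset H) (f : S -> T),
    bijective f -> hequivariant f -> iadm S -> iadm T;
  iadm_sub : forall H (S T : hset H) (f : S -> T),
    injective f -> hequivariant f -> iadm T -> iadm S;
  iadm_sum : forall H (S T : hset H), iadm S -> iadm T -> iadm (hset_sum S T);
  iadm_res : forall H K (sKH : K \subset H) (T : hset H),
    iadm T -> iadm (hset_res sKH T);
  iadm_conj : forall H a (T : hset H), iadm T -> iadm (hset_conj a T);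
  iadm_ind : forall H K (T : hset K), K \subset H ->
    iadm T -> iadm (hset_cosets H K) -> iadm (hset_ind H T)
}.

Definition sub_indexing (I J : indexing_system) : Prop :=
  forall H (T : hset H), I H T -> J H T.

(* Antisymmetry is a consequence of [tr_sub]. *)
Record transfer_system (tr : {group gT} -> {group gT} -> Prop) : Prop :=
  TransferSystem {
  tr_sub : forall K H, tr K H -> K \subset H;
  tr_refl : forall H, tr H H;
  tr_trans : forall L K H, tr L K -> tr K H -> tr L H;
  tr_conj : forall K H a, tr K H -> tr (K :^ a)%G (H :^ a)%G;
  tr_res : forall K H L, tr K H -> L \subset H -> tr (K :&: L)%G L
}.

Definition transfer_of (I : indexing_system) (K H : {group gT}) : Prop :=
  K \subset H /\ I H (hset_cosets H K).

Definition generated_transfer (E : {group gT} -> {group gT} -> Prop)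
    (K H : {group gT}) : Prop :=
  forall tr, transfer_system tr -> (forall L M, E L M -> tr L M) -> tr K H.

Definition disk_like (I : indexing_system) : Prop :=
  exists E : {group gT} -> {group gT} -> Prop,
    (forall K H, E K H -> H = [set: gT]%G) /\
    (forall K H, transfer_of I K H <-> generated_transfer E K H).

End HSets.

Section Gamma.
Variable gT : finGroupType.
Implicit Types I J : indexing_system gT.

(* MathComp composes permutations from left to right, so that a homomorphism
   to [Sigma_n] with its usual product is antimultiplicative into ['S_n]. *)
Record sigma_hom (n : nat) := SigmaHom {
  shom :> gT -> 'S_n;
  shomM : forall g h i, shom (g * h) i = shom g (shom h i)
}.

Lemma shom1 n (al : sigma_hom n) i : al 1 i = i.
Proof. by apply: (@perm_inj _ (al 1)); rewrite -shomM mulg1. Qed.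

Definition trivial_hom n : sigma_hom n.
Proof. by refine (@SigmaHom n (fun=> 1) _) => g h i; rewrite !perm1. Defined.

Definition alpha_set n (al : sigma_hom n) : hset [set: gT]%G :=
  @HSet gT [set: gT]%G 'I_n (fun g i => al g i) (shom1 al)
    (fun g h x _ _ => shomM al g h x).

Definition alpha_plus n (al : sigma_hom n) : bgspace gT.
Proof.
unshelve refine (@BGSpace gT (@GSpace gT (discrete_topology (option 'I_n))
  (cgwh_discrete _) (fun g => omap (al g)) _ _ _) None _).
- by case=> //= i; rewrite shom1.
- by move=> g h [] //= i; rewrite shomM.
- by move=> g; apply/continuousP => A _; exact: discrete_open.
- by [].
Defined.

Record gamma_obj I := GammaObj {
  gdeg : nat;
  galpha : sigma_hom gdeg;
  galpha_adm : I [set: gT]%G (alpha_set galpha)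
}.

Definition gspc I (S : gamma_obj I) : bgspace gT := alpha_plus (galpha S).

Definition nplus (n : nat) : bgspace gT := alpha_plus (trivial_hom n).

Definition triv_adm I (n : nat) := I [set: gT]%G (alpha_set (trivial_hom n)).

Lemma triv_admP I n : triv_adm I n.
Proof. by apply: iadm_trivial => h x _ /=; rewrite perm1. Qed.

Definition triv_obj I n (a : triv_adm I n) : gamma_obj I :=
  @GammaObj I n (trivial_hom n) a.

Definition gamma_incl I J (sIJ : sub_indexing I J) (S : gamma_obj I) :
  gamma_obj J := GammaObj (sIJ _ _ (galpha_adm S)).

(* Functors enriched over based G-spaces: since based G-maps out of a smash
   product are determined by their values on points, the enriched axioms can be
   checked on points of the mapping spaces, which are all based maps. *)
Record gamma_functor I := GammaFunctor {
  gobj :> gamma_obj I -> bgspace gT;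
  gmor : forall S T, bmap (gspc S) (gspc T) -> bmap (gobj S) (gobj T);
  gmor_continuous : forall S T,
    continuous (@gmor S T :
      mapsp (gspc S) (gspc T) -> mapsp (gobj S) (gobj T));
  gmor_conj : forall S T g (f : bmap (gspc S) (gspc T)),
    gmor (bconj g f) = bconj g (gmor f);
  gmor_zero : forall S T,
    gmor (bzero (gspc S) (gspc T)) = bzero (gobj S) (gobj T);
  gmor_id : forall S, gmor (bid (gspc S)) = bid (gobj S);
  gmor_comp : forall S T U (f : bmap (gspc T) (gspc U))
    (e : bmap (gspc S) (gspc T)), gmor (bcomp f e) = bcomp (gmor f) (gmor e)
}.
Arguments gmor {I} _ {S T} : rename.

(* For a group [S] acting on n_+ by [e], the (G x S)-space X(n_+). *)
Section ProductAction.
Variables (I : indexing_system gT) (X : gamma_functor I).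
Variables (n : nat) (a : triv_adm I n).
Local Notation np := (nplus n).
Variables (S : finGroupType) (e : S -> bmap np np).
Hypothesis e1 : e 1 = bid np.
Hypothesis eM : forall s t, e (s * t) = bcomp (e s) (e t).

Lemma conj_triv (f : bmap np np) g : bconj g f = f.
Proof.
have act_triv h (x : np) : gact h x = x by case: x => [i|] //=; rewrite perm1.
apply: bmap_eq => x.
have -> : bconj g f x = gact g (f (gact g^-1 x)) by [].
by rewrite !act_triv.
Qed.

Definition product_space : gspace (gT * S)%type.
Proof.
unshelve refine (@GSpace (gT * S)%type (X (triv_obj a)) (gcar_cgwh _)
  (fun p x => gact p.1 (@gmor I X (triv_obj a) (triv_obj a) (e p.2) x)) _ _ _).
- by move=> x; rewrite /= e1 (gmor_id X (triv_obj a)) gact1.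
- move=> [g s] [h t] x /=; rewrite eM.
  rewrite (@gmor_comp I X (triv_obj a) (triv_obj a) (triv_obj a)) gactM /=.
  rewrite -[in RHS](conj_triv (e s) h).
  rewrite (@gmor_conj I X (triv_obj a) (triv_obj a)) /=.
  by rewrite -[gact h^-1 _]gactM mulVg gact1.
- move=> [g s] x; apply: continuous_comp; first exact: bfun_continuous.
  exact: gact_continuous.
Defined.
End ProductAction.

Section Injection.
Variables m n : nat.
Local Notation mp := (nplus m).
Local Notation np := (nplus n).
Variables (phi : bmap mp np) (phi_inj : injective phi).

Definition inj_im : {set 'I_n} :=
  [set i | [exists j : 'I_m, (phi (Some j) : option 'I_n) == Some i]].

Definition sigma_phi : {group 'S_n} := 'N(inj_im | 'P)%G.

Definition perm_bmap (s : 'S_n) : bmap np np.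
Proof.
refine (@BMap gT np np (omap s) _ erefl).
by apply/continuousP => A _; exact: (@discrete_open (discrete_topology _)).
Defined.

(* The retraction of n_+ onto m_+ that sends to 0 all points outside of the
    image of [phi]. *)
Definition inj_retr : bmap np mp.
Proof.
unshelve refine (@BMap gT np mp
  (fun y : option 'I_n => [pick j : 'I_m | (phi (Some j) : option 'I_n) == y]) _ _).
- by apply/continuousP => A _; exact: (@discrete_open (discrete_topology _)).
- case: pickP => //= j /eqP; rewrite -[X in _ = X](bfun_base phi) /=.
  by move=> /phi_inj.
Defined.

(* The permutation of m_+ that [s] in [sigma_phi] restricts to. *)
Definition perm_restr (s : 'S_n) : bmap mp mp :=
  bcomp inj_retr (bcomp (perm_bmap s) phi).

Lemma perm_bmap1 : perm_bmap 1 = bid np.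
Proof. by apply: bmap_eq => -[i|] //=; rewrite perm1. Qed.

Lemma perm_bmapM s t : perm_bmap (s * t) = bcomp (perm_bmap t) (perm_bmap s).
Proof. by apply: bmap_eq => -[i|] //=; rewrite permM. Qed.

Lemma inj_retrK (j : mp) : inj_retr (phi j) = j.
Proof.
rewrite /=; case: pickP => [k /eqP /phi_inj -> //|].
by case: j => [j /(_ j)|_]; rewrite ?eqxx // -[X in _ = X](bfun_base inj_retr).
Qed.

Lemma perm_restr1 : perm_restr 1 = bid mp.
Proof.
by apply: bmap_eq => j; rewrite /perm_restr perm_bmap1; exact: inj_retrK.
Qed.

Lemma sigma_phiP s j : s \in sigma_phi ->
  exists k : mp, phi k = perm_bmap s (phi j).
Proof.
move=> sP; pose psi : option 'I_m -> option 'I_n := phi.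
suff [k] : exists k, psi k = omap s (psi j) by exists k.
have psi0 : psi None = None := bfun_base phi.
case: j => [j|]; last by exists None; rewrite psi0.
case E: (psi (Some j)) => [i|]; last by exists None.
have iP : i \in inj_im by rewrite inE; apply/existsP; exists j; apply/eqP.
have : s i \in inj_im by rewrite -[s i]/(aperm i s) (astabsP sP).
by rewrite inE => /existsP[k /eqP phik]; exists (Some k).
Qed.

Lemma perm_restrP s j : s \in sigma_phi ->
  phi (perm_restr s j) = perm_bmap s (phi j).
Proof.
move=> /(sigma_phiP j)[k phik].
have -> : perm_restr s j = inj_retr (perm_bmap s (phi j)) by [].
by rewrite -phik inj_retrK.
Qed.

Lemma perm_restrM s t : s \in sigma_phi ->
  perm_restr (s * t) = bcomp (perm_restr t) (perm_restr s).
Proof.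
move=> sP; apply: bmap_eq => j.
have -> : bcomp (perm_restr t) (perm_restr s) j =
  inj_retr (perm_bmap t (phi (perm_restr s j))) by [].
by rewrite perm_restrP // {1}/perm_restr perm_bmapM.
Qed.

Variables (I : indexing_system gT) (X : gamma_functor I).
Variables (am : triv_adm I m) (an : triv_adm I n).

(* The permutations are inverted because MathComp's product of ['S_n] is
   opposite to the composition that X(n_+) is acted on through. *)
Let etgt (s : subg_of sigma_phi) := perm_bmap (sgval s)^-1.
Let esrc (s : subg_of sigma_phi) := perm_restr (sgval s)^-1.

Let etgt1 : etgt 1 = bid np.
Proof. by rewrite /etgt invg1 perm_bmap1. Qed.

Let etgtM s t : etgt (s * t) = bcomp (etgt s) (etgt t).
Proof. by rewrite /etgt /= invMg perm_bmapM. Qed.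

Let esrc1 : esrc 1 = bid mp.
Proof. by rewrite /esrc invg1 perm_restr1. Qed.

Let esrcM s t : esrc (s * t) = bcomp (esrc s) (esrc t).
Proof. by rewrite /esrc /= invMg perm_restrM // groupV subgP. Qed.

Definition phi_source : gspace (gT * subg_of sigma_phi)%type :=
  product_space X am esrc1 esrcM.
Definition phi_target : gspace (gT * subg_of sigma_phi)%type :=
  product_space X an etgt1 etgtM.

End Injection.

Definition cofibrant_injections (R : realType) I (X : gamma_functor I) : Prop :=
  forall m n (phi : bmap (nplus m) (nplus n)) (phi_inj : injective phi),
    cofibration R
      (A := phi_source phi_inj X (triv_admP I m))
      (X := phi_target phi X (triv_admP I n))
      (@gmor I X (triv_obj (triv_admP I m)) (triv_obj (triv_admP I n)) phi).

Record gamma_space (R : realType) I := GammaSpace {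
  gsfun :> gamma_functor I;
  gs_cofibrant : cofibrant_injections R gsfun
}.

Record gamma_nat I (X Y : gamma_functor I) := GammaNat {
  gnat :> forall S, bmap (X S) (Y S);
  gnat_equivariant : forall S, equivariant (gnat S);
  gnat_natural : forall S T (f : bmap (gspc S) (gspc T)),
    bcomp (gnat T) (gmor X f) = bcomp (gmor Y f) (gnat S)
}.

Lemma gamma_nat_eq I (X Y : gamma_functor I) (u v : gamma_nat X Y) :
  (forall S x, u S x = v S x) -> u = v.
Proof.
case: u v => [u eu nu] [v ev nv] /= uv.
have {}uv : u = v by apply: functional_extensionality_dep => S; exact: bmap_eq.
by subst v; rewrite (Prop_irrelevance eu ev) (Prop_irrelevance nu nv).
Qed.

Definition gamma_nat_id I (X : gamma_functor I) : gamma_nat X X.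
Proof.
refine (@GammaNat I X X (fun S => bid (X S)) _ _) => //.
by move=> S T f; exact: bmap_eq.
Defined.

Definition gamma_nat_comp I (X Y Z : gamma_functor I)
  (v : gamma_nat Y Z) (u : gamma_nat X Y) : gamma_nat X Z.
Proof.
refine (@GammaNat I X Z (fun S => bcomp (v S) (u S)) _ _).
- by move=> S g x /=; rewrite !gnat_equivariant.
- move=> S T f; apply: bmap_eq => x /=.
  have /(congr1 (fun b => bfun b x)) /= -> := gnat_natural u f.
  by have /(congr1 (fun b => bfun b (u S x))) /= -> := gnat_natural v f.
Defined.

End Gamma.
Arguments gmor {gT I} _ {S T} : rename.

Record category := Category {
  cobj :> Type;
  chom : cobj -> cobj -> Type;
  cid : forall A, chom A A;
  ccomp : forall A B C, chom B C -> chom A B -> chom A C;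
  ccomp1m : forall A B (f : chom A B), ccomp (cid B) f = f;
  ccompm1 : forall A B (f : chom A B), ccomp f (cid A) = f;
  ccompA : forall A B C D (h : chom C D) (g : chom B C) (f : chom A B),
    ccomp h (ccomp g f) = ccomp (ccomp h g) f
}.
Arguments chom {c} _ _ : rename.
Arguments cid {c} _ : rename.
Arguments ccomp {c A B C} _ _ : rename.

Definition is_iso (C : category) (A B : C) (f : chom A B) : Prop :=
  exists g : chom B A, ccomp g f = cid A /\ ccomp f g = cid B.

Record cfunctor (C D : category) := CFunctor {
  fobj :> C -> D;
  fhom : forall A B, chom A B -> chom (fobj A) (fobj B);
  fhom_id : forall A, fhom (cid A) = cid (fobj A);
  fhom_comp : forall A B E (g : chom B E) (f : chom A B),
    fhom (ccomp g f) = ccomp (fhom g) (fhom f)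
}.
Arguments fhom {C D} _ {A B} _ : rename.

Record adjunction (C D : category) (P : cfunctor C D) (U : cfunctor D C) :=
  Adjunction {
  aunit : forall X : C, chom X (U (P X));
  acounit : forall Y : D, chom (P (U Y)) Y;
  aunit_natural : forall (X X' : C) (f : chom X X'),
    ccomp (aunit X') f = ccomp (fhom U (fhom P f)) (aunit X);
  acounit_natural : forall (Y Y' : D) (f : chom Y Y'),
    ccomp f (acounit Y) = ccomp (acounit Y') (fhom P (fhom U f));
  atriangle_left : forall X,
    ccomp (acounit (P X)) (fhom P (aunit X)) = cid (P X);
  atriangle_right : forall Y,
    ccomp (fhom U (acounit Y)) (aunit (U Y)) = cid (U Y)
}.
Arguments aunit {C D P U} _ _ : rename.
Arguments acounit {C D P U} _ _ : rename.

Definition adjoint_equivalence (C D : category) (P : cfunctor C D)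
    (U : cfunctor D C) (adj : adjunction P U) : Prop :=
  (forall X, is_iso (aunit adj X)) /\ (forall Y, is_iso (acounit adj Y)).

Section ChangeOfIndexing.
Variables (R : realType) (gT : finGroupType).
Implicit Types I J : indexing_system gT.

Definition gamma_category I : category.
Proof.
unshelve refine (@Category (gamma_space R I) (fun X Y => gamma_nat X Y)
  (fun X => gamma_nat_id X) (fun X Y Z v u => gamma_nat_comp v u) _ _ _).
- by move=> X Y u; exact: gamma_nat_eq.
- by move=> X Y u; exact: gamma_nat_eq.
- by move=> X Y Z W w v u; exact: gamma_nat_eq.
Defined.

Section Restriction.
Variables (I J : indexing_system gT) (sIJ : sub_indexing I J).

Definition restr_functor (Y : gamma_functor J) : gamma_functor I :=
  @GammaFunctor gT I (fun S => Y (gamma_incl sIJ S))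
    (fun S T f =>
       @gmor _ _ Y (gamma_incl sIJ S) (gamma_incl sIJ T) f)
    (fun S T => @gmor_continuous _ _ Y (gamma_incl sIJ S) (gamma_incl sIJ T))
    (fun S T => @gmor_conj _ _ Y (gamma_incl sIJ S) (gamma_incl sIJ T))
    (fun S T => @gmor_zero _ _ Y (gamma_incl sIJ S) (gamma_incl sIJ T))
    (fun S => @gmor_id _ _ Y (gamma_incl sIJ S))
    (fun S T U => @gmor_comp _ _ Y (gamma_incl sIJ S) (gamma_incl sIJ T)
       (gamma_incl sIJ U)).

Lemma restr_cofibrant (Y : gamma_space R J) :
  cofibrant_injections R (restr_functor Y).
Proof.
move=> m n phi phi_inj; have := gs_cofibrant Y phi_inj.
rewrite (Prop_irrelevance (triv_admP J m) (sIJ (triv_admP I m))).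
by rewrite (Prop_irrelevance (triv_admP J n) (sIJ (triv_admP I n))).
Qed.

Definition restr_space (Y : gamma_space R J) : gamma_space R I :=
  GammaSpace (restr_cofibrant Y).

Definition restr_nat (Y Y' : gamma_functor J) (u : gamma_nat Y Y') :
    gamma_nat (restr_functor Y) (restr_functor Y') :=
  @GammaNat gT I (restr_functor Y) (restr_functor Y')
    (fun S => u (gamma_incl sIJ S))
    (fun S => @gnat_equivariant _ _ _ _ u (gamma_incl sIJ S))
    (fun S T => @gnat_natural _ _ _ _ u (gamma_incl sIJ S) (gamma_incl sIJ T)).

Definition restriction : cfunctor (gamma_category J) (gamma_category I).
Proof.
refine (@CFunctor (gamma_category J) (gamma_category I) restr_space
  (fun Y Y' u => restr_nat u) _ _).
- by move=> Y; exact: gamma_nat_eq.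
- by move=> Y Y' Y'' v u; exact: gamma_nat_eq.
Defined.

(* A cowedge from [Gamma_J(S, T) /\ X(S)], [S] in Gamma_I, to [Z]. A based
    map out of the smash product is given by a map out of the product that
    sends both axes to the base point. *)
Record cowedge (X : gamma_functor I) (T : gamma_obj J) (Z : bgspace gT)
    (k : forall S : gamma_obj I,
       bmap (gspc (gamma_incl sIJ S)) (gspc T) -> X S -> Z) : Prop := Cowedge {
  cw_continuous : forall S, continuous ((fun p => k S p.1 p.2) :
    kprod (mapsp (gspc (gamma_incl sIJ S)) (gspc T)) (X S) -> Z);
  cw_basel : forall S x, k S (bzero _ _) x = gbase Z;
  cw_baser : forall S f, k S f (gbase (X S)) = gbase Z;
  cw_equivariant : forall S g f x,
    k S (bconj g f) (gact g x) = gact g (k S f x);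
  cw_dinatural : forall (S S' : gamma_obj I) (e : bmap (gspc S) (gspc S'))
      (f : bmap (gspc (gamma_incl sIJ S')) (gspc T)) (x : X S),
    k S (@bcomp _ (gspc (gamma_incl sIJ S)) _ _ f e) x = k S' f (gmor X e x)
}.

(* The enriched coend is a coequalizer of wedges of smash products. As the
   smash product is closed, it has the ordinary universal property. *)
Definition is_coend (X : gamma_functor I) (T : gamma_obj J) (Z : bgspace gT)
    (k : forall S : gamma_obj I,
       bmap (gspc (gamma_incl sIJ S)) (gspc T) -> X S -> Z) : Prop :=
  cowedge k /\
  forall (Z' : bgspace gT) (k' : forall S : gamma_obj I,
      bmap (gspc (gamma_incl sIJ S)) (gspc T) -> X S -> Z'),
    cowedge k' ->
    exists! h : bmap Z Z', equivariant h /\ forall S f x, h (k S f x) = k' S f x.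

(* The left adjoint [P] is the enriched left Kan extension: its unit makes
    [P X (T)] the coend of [Gamma_J(S, T) /\ X(S)]. *)
Definition is_left_kan (P : cfunctor (gamma_category I) (gamma_category J))
    (adj : adjunction P restriction) : Prop :=
  forall (X : gamma_space R I) (T : gamma_obj J),
    is_coend (X := X) (T := T) (Z := (P X : gamma_space R J) T)
      (fun S f x =>
         @gmor _ _ (P X : gamma_space R J) (gamma_incl sIJ S) T f
           ((aunit adj X : gamma_nat X (restr_functor (P X : gamma_space R J)))
              S x)).

End Restriction.
End ChangeOfIndexing.

(* Main.v *)
Require Import Defs.
From mathcomp Require Import all_boot all_order all_algebra all_fingroup.
From mathcomp Require Import all_classical all_reals all_analysis.
Import Defs.

(** Why the theorem holds.  The mapping G-spaces F(S_+, T_+) consist of all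
    based maps, equivariant or not, so in Gamma_J every object n^alpha_+ is
    isomorphic to n_+ through the identity function [relabel] of the underlying
    set.  That isomorphism is not G-equivariant: conjugation by g changes it by
    the permutation alpha(g) ([bconj_relabel]).  Hence the G-space X(n^alpha_+)
    is determined by the Gamma-G-space underlying X: as a space it is X(n_+), on
    which g acts as the composite of its given action with X(alpha(g)).  This is
    [twist], and it makes sense for every alpha, whether or not n^alpha is
    admissible for I.

    Sending n^alpha_+ to the twisted space, and a based map f to X(f) for f
    viewed as a map m_+ -> n_+, extends a functor X on Gamma_I to a functor
    [extension] on Gamma_J.  The maps X([relabel]) are natural isomorphisms from
    X to the restriction of its extension ([ext_unit]) and, for Y on Gamma_J,
    from the extension of the restriction of Y to Y ([ext_counit]), so extension
    is left adjoint to restriction and this adjunction is an equivalence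
    ([extension_equivalence]).  The cofibration condition only concerns the
    values at the n_+, and passes through [ext_unit] ([cofibrant_iso]).

    Extension is the left Kan extension: Gamma_J(S_+, T_+) contains the
    isomorphism [relabel] from n_+, an object of Gamma_I, to T_+, so by
    dinaturality a cowedge on Gamma_J(S_+, T_+) /\ X(S_+) is determined by its
    value at [relabel] in the summand S = n ([extension_is_coend], a co-Yoneda
    argument).  Finally any other left adjoint of restriction is
    canonically isomorphic to extension, compatibly with units and counits, and
    thus is an equivalence too ([adjoint_equivalence_unique]).  *)

Set Implicit Arguments.
Unset Strict Implicit.
Unset Printing Implicit Defensive.
Local Open Scope classical_set_scope.
Local Open Scope group_scope.

(** * Compactly generated spaces *)

Lemma kify_openE (X : topologicalType) (U : set (kify X)) : open U = kopen U.
Proof. by []. Qed.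

Lemma kify_continuous (X Y : topologicalType) (f : X -> Y) :
  continuous f -> continuous (f : kify X -> kify Y).
Proof.
move=> cf; apply/continuousP => U; rewrite !kify_openE => oU K u hK cu.
apply: (oU K (f \o u) hK) => x; apply: continuous_comp; first exact: cu.
exact: cf.
Qed.

(** Test maps into [X] detect its open sets, and their composites with [f] are
    test maps into [Y]. *)
Lemma continuous_to_kify (X Y : topologicalType) (f : X -> Y) :
  compactly_generated X -> continuous f -> continuous (f : X -> kify Y).
Proof.
move=> kX cf; apply/continuousP => U oU; rewrite -closedC.
apply: kX => K u hK cu.
rewrite preimage_setC closedC.
apply: (oU K (f \o u) hK) => x; apply: continuous_comp; first exact: cu.
exact: cf.
Qed.

Lemma kify_open (X : topologicalType) (U : set X) :
  open U -> open (U : set (kify X)).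
Proof. by rewrite kify_openE => oU K u _ /continuousP; apply. Qed.

Lemma compact_hausdorff_unit : compact_hausdorff (discrete_topology unit).
Proof.
split; last by move=> [] [].
have -> : [set: discrete_topology unit] = [set tt : discrete_topology unit].
  by apply/seteqP; split => -[].
exact: compact_set1.
Qed.

(** A discrete factor removes the need for an evaluation or exponential law:
    the product is then a disjoint union of copies of [Y]. *)
Lemma kprod_continuous (X Y Z : topologicalType) (k : X -> Y -> Z) :
  (forall x : X, open [set x]) -> (forall x, continuous (k x)) ->
  continuous ((fun p => k p.1 p.2) : kprod X Y -> Z).
Proof.
move=> dX ck; have cE : continuous (fun p : X * Y => k p.1 p.2).
  apply/continuousP => U oU.
  have -> : (fun p : X * Y => k p.1 p.2) @^-1` U =
      \bigcup_x (fst @^-1` [set x] `&` snd @^-1` (k x @^-1` U)).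
    apply/seteqP; split => [[x y] Ukxy|[x y] [_ _ [/= -> //]]].
    by exists x.
  apply: bigcup_open => x _; apply: openI.
    by apply: open_comp => // p _; exact: cvg_fst.
  apply: open_comp => [p _|]; first exact: cvg_snd.
  by have /continuousP := ck x; apply.
by apply/continuousP => U oU; apply: kify_open; have /continuousP := cE; apply.
Qed.

Section MappingSpaces.
Variable K : finGroupType.

Lemma bmap_co_eval_open (X Y : bgspace K) (x : X) (U : set Y) : open U ->
  open [set f : bmap_co X Y | U ((f : bmap X Y) x)].
Proof.
move=> oU; set W := (W in open W).
exists [set W]; last by rewrite bigcup_set1.
(* Evaluation at [x] is tested by the map from a point. *)
move=> _ ->; apply: finI_from1.
exists (discrete_topology unit), (fun=> x), U; split => //.
- exact: compact_hausdorff_unit.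
- by move=> ?; exact: cvg_cst.
- by apply/seteqP; split => f /= Uf //; exact: (Uf tt).
Qed.

(** A map out of a finite space is pinned down by finitely many evaluations,
    each of which is an open condition when the target is discrete.  So the
    mapping spaces of Gamma are discrete, and enrichment imposes no continuity
    condition on a functor on Gamma. *)
Lemma mapsp_discrete (X Y : bgspace K) (T : finType) (t : T -> X) :
  (forall x, exists i, x = t i) -> (forall y : Y, open [set y]) ->
  forall W : set (mapsp X Y), open W.
Proof.
move=> tX dY W; apply: (@kify_open (bmap_co X Y)); rewrite openE => f Wf.
have near_f : \forall g \near f, forall i : T,
    (g : bmap X Y) (t i) = (f : bmap X Y) (t i).
  apply: (@filter_forall (bmap_co X Y) T
    (fun i => [set g : bmap_co X Y |
      (g : bmap X Y) (t i) = (f : bmap X Y) (t i)]) (nbhs f) (nbhs_filter f)).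
  move=> i; apply: open_nbhs_nbhs; split => //.
  exact: (bmap_co_eval_open (t i) (dY _)).
apply: filterS near_f => g gf; suff -> : g = f by [].
by apply: bmap_eq => x; have [i ->] := tX x.
Qed.

End MappingSpaces.

(** * Uniqueness of left adjoints *)

Section Adjunctions.
Variables (C D : category).

Lemma is_iso_comp (A B E : C) (g : chom B E) (f : chom A B) :
  is_iso g -> is_iso f -> is_iso (ccomp g f).
Proof.
move=> [g' [g'g gg']] [f' [f'f ff']]; exists (ccomp f' g'); split.
  by rewrite -ccompA (ccompA g') g'g ccomp1m.
by rewrite -ccompA (ccompA f) ff' ccomp1m.
Qed.

Lemma is_iso_fhom (F : cfunctor C D) (A B : C) (f : chom A B) :
  is_iso f -> is_iso (fhom F f).
Proof.
move=> [f' [f'f ff']]; exists (fhom F f').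
by rewrite -!fhom_comp f'f ff' !fhom_id.
Qed.

Section Uniqueness.
Variable U : cfunctor D C.

Lemma adj_transposeK (P : cfunctor C D) (adj : adjunction P U) X Y
    (f : chom (P X) Y) :
  ccomp (acounit adj Y) (fhom P (ccomp (fhom U f) (aunit adj X))) = f.
Proof.
by rewrite fhom_comp ccompA -acounit_natural -ccompA atriangle_left ccompm1.
Qed.

Lemma adj_hom_eq (P : cfunctor C D) (adj : adjunction P U) X Y
    (f g : chom (P X) Y) :
  ccomp (fhom U f) (aunit adj X) = ccomp (fhom U g) (aunit adj X) -> f = g.
Proof. by move=> fg; rewrite -(adj_transposeK adj f) fg adj_transposeK. Qed.

Definition adj_compare (P Q : cfunctor C D) (adjP : adjunction P U)
  (adjQ : adjunction Q U) (X : C) : chom (P X) (Q X) :=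
  ccomp (acounit adjP (Q X)) (fhom P (aunit adjQ X)).

Section Compare.
Variables (P Q : cfunctor C D) (adjP : adjunction P U) (adjQ : adjunction Q U).

Lemma adj_compare_unit X :
  ccomp (fhom U (adj_compare adjP adjQ X)) (aunit adjP X) = aunit adjQ X.
Proof.
by rewrite fhom_comp -ccompA -aunit_natural ccompA atriangle_right ccomp1m.
Qed.

Lemma adj_compare_counit Y :
  ccomp (acounit adjQ Y) (adj_compare adjP adjQ (U Y)) = acounit adjP Y.
Proof.
apply: (adj_hom_eq (adj := adjP)).
by rewrite fhom_comp -ccompA adj_compare_unit !atriangle_right.
Qed.

End Compare.

Lemma adj_compareK (P Q : cfunctor C D) (adjP : adjunction P U)
    (adjQ : adjunction Q U) X :
  ccomp (adj_compare adjQ adjP X) (adj_compare adjP adjQ X) = cid (P X).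
Proof.
apply: (adj_hom_eq (adj := adjP)).
by rewrite fhom_comp -ccompA !adj_compare_unit fhom_id ccomp1m.
Qed.

Lemma adj_compare_iso (P Q : cfunctor C D) (adjP : adjunction P U)
    (adjQ : adjunction Q U) X : is_iso (adj_compare adjP adjQ X).
Proof. by exists (adj_compare adjQ adjP X); split; exact: adj_compareK. Qed.

End Uniqueness.
End Adjunctions.

(** The comparison of two left adjoints is an isomorphism, and it turns the unit
    and the counit of one adjunction into those of the other. *)
Lemma adjoint_equivalence_unique (C D : category) (U : cfunctor D C)
    (P Q : cfunctor C D) (adjP : adjunction P U) (adjQ : adjunction Q U) :
  adjoint_equivalence adjP -> adjoint_equivalence adjQ.
Proof.
move=> [iu ic]; split => [X|Y].
  rewrite -(adj_compare_unit adjP adjQ); apply: is_iso_comp => //.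
  by apply: is_iso_fhom; exact: adj_compare_iso.
rewrite -(adj_compare_counit adjQ adjP); apply: is_iso_comp => //.
exact: adj_compare_iso.
Qed.

(** * Forgetting the actions on finite sets *)

Section Relabelling.
Variable gT : finGroupType.

Definition relabel n (al be : sigma_hom gT n) :
  bmap (alpha_plus al) (alpha_plus be).
Proof.
refine (@BMap gT (alpha_plus al) (alpha_plus be) id _ erefl).
by apply/continuousP => A _; exact: (@discrete_open (discrete_topology _)).
Defined.

Definition underlying m n (al : sigma_hom gT m) (be : sigma_hom gT n)
    (f : bmap (alpha_plus al) (alpha_plus be)) :
    bmap (nplus gT m) (nplus gT n) :=
  bcomp (relabel be (trivial_hom gT n))
    (bcomp f (relabel (trivial_hom gT m) al)).

(** The failure of equivariance of [relabel], and the source of the twist. *)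
Lemma bconj_relabel n (al : sigma_hom gT n) g :
  bconj g (relabel (trivial_hom gT n) al) =
  bcomp (relabel (trivial_hom gT n) al) (perm_bmap gT (al g)).
Proof. by apply: bmap_eq => -[i|] //=; rewrite perm1. Qed.

Lemma alpha_mapsp_open m n (al : sigma_hom gT m) (be : sigma_hom gT n)
    (W : set (mapsp (alpha_plus al) (alpha_plus be))) : open W.
Proof.
exact: (@mapsp_discrete gT (alpha_plus al) (alpha_plus be)
  (option 'I_m) id (fun x => ex_intro _ x erefl)
  (fun y => @discrete_open (discrete_topology _) _)).
Qed.

End Relabelling.

Lemma gnat_gmor (gT : finGroupType) (I : indexing_system gT)
    (X Y : gamma_functor I) (u : gamma_nat X Y) (S T : gamma_obj I)
    (f : bmap (gspc S) (gspc T)) x :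
  u T (gmor X f x) = gmor Y f (u S x).
Proof. exact: (congr1 (fun b => bfun b x) (gnat_natural u f)). Qed.

Section Values.
Variables (gT : finGroupType) (I : indexing_system gT) (X : gamma_functor I).

Definition nobj n : gamma_obj I := triv_obj (triv_admP I n).

Lemma gmor_bcomp (S T U : gamma_obj I) (f : bmap (gspc T) (gspc U))
    (e : bmap (gspc S) (gspc T)) x :
  gmor X f (gmor X e x) = gmor X (bcomp f e) x.
Proof. by rewrite gmor_comp. Qed.

Lemma gact_gmor (S T : gamma_obj I) (f : bmap (gspc S) (gspc T)) g x :
  gact g (gmor X f x) = gmor X (bconj g f) (gact g x).
Proof. by rewrite gmor_conj /= -gactM mulVg gact1. Qed.

(** Every map between trivial G-sets is fixed under conjugation, hence acts
    equivariantly.  This is why the two actions combined in [twist] commute. *)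
Lemma gact_gmor_nobj m n (f : bmap (gspc (nobj m)) (gspc (nobj n))) g x :
  gact g (gmor X f x) = gmor X f (gact g x).
Proof.
rewrite gact_gmor; congr (gmor X _ _); apply: bmap_eq => y /=.
have triv k h (z : nplus gT k) : gact h z = z.
  by case: z => [i|] //=; rewrite perm1.
rewrite -[omap _ _]/(gact g _ : nplus gT n) triv.
by rewrite -[omap _ _]/(gact g^-1 _ : nplus gT m) triv.
Qed.

(** This is X(n^al_+) up to isomorphism when n^al is admissible, and the value
    that the extension of X is bound to take there when it is not. *)
Definition twist n (al : sigma_hom gT n) : bgspace gT.
Proof.
unshelve refine (@BGSpace gT (@GSpace gT (X (nobj n)) (gcar_cgwh _)
  (fun g x => gact g (@gmor _ _ X (nobj n) (nobj n) (perm_bmap gT (al g)) x))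
  _ _ _) (gbase (X (nobj n))) _).
- move=> x; rewrite gact1.
  rewrite (_ : perm_bmap gT (al 1) = bid _) ?(gmor_id X (nobj n)) //.
  by apply: bmap_eq => -[i|] //=; rewrite shom1.
- move=> g h x; rewrite gactM -(gact_gmor_nobj _ h) gmor_bcomp.
  congr (gact g (gact h (gmor X _ _))).
  by apply: bmap_eq => -[i|] //=; rewrite shomM.
- move=> g x; apply: continuous_comp; first exact: bfun_continuous.
  exact: gact_continuous.
- move=> g; apply: etrans (@gact_base _ (X (nobj n)) g).
  by congr (@gact _ (X (nobj n)) g _); exact: bfun_base.
Defined.

Definition to_twist n (al : sigma_hom gT n) : bmap (X (nobj n)) (twist al) :=
  @BMap gT (X (nobj n)) (twist al) id (fun x => cvg_id) erefl.

Definition of_twist n (al : sigma_hom gT n) : bmap (twist al) (X (nobj n)) :=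
  @BMap gT (twist al) (X (nobj n)) id (fun x => cvg_id) erefl.

End Values.

Definition twist_map (gT : finGroupType) (I : indexing_system gT)
    (X Y : gamma_functor I) m n (al : sigma_hom gT m) (be : sigma_hom gT n)
    (f : bmap (X (nobj I m)) (Y (nobj I n))) : bmap (twist X al) (twist Y be) :=
  @BMap gT (twist X al) (twist Y be) f (bfun_continuous (b:=f)) (bfun_base f).

(** * Extension along the inclusion of Gamma_I in Gamma_J *)

Section Extension.
Variables (gT : finGroupType) (I J : indexing_system gT).

Definition extension (X : gamma_functor I) : gamma_functor J.
Proof.
refine (@GammaFunctor gT J (fun T => twist X (galpha T))
  (fun S T f => twist_map (galpha S) (galpha T)
     (@gmor _ _ X (nobj I (gdeg S)) (nobj I (gdeg T)) (underlying f)))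
  _ _ _ _ _).
- by move=> S T; apply/continuousP => W _; exact: alpha_mapsp_open.
- move=> S T g f; apply: bmap_eq => x /=.
  rewrite !(gact_gmor_nobj (X:=X)) -gactM mulgV gact1 !gmor_bcomp.
  by congr (gmor X _ _); apply: bmap_eq.
- move=> S T; apply: bmap_eq => x /=.
  rewrite (_ : underlying _ = bzero _ _); last exact: bmap_eq.
  by rewrite (gmor_zero X).
- move=> S; apply: bmap_eq => x /=.
  rewrite (_ : underlying _ = bid _); last exact: bmap_eq.
  by rewrite (gmor_id X (nobj I _)).
- move=> S T U f e; apply: bmap_eq => x /=.
  by rewrite gmor_bcomp; congr (gmor X _ x); apply: bmap_eq.
Defined.

Definition extension_nat (X X' : gamma_functor I) (u : gamma_nat X X') :
  gamma_nat (extension X) (extension X').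
Proof.
refine (@GammaNat gT J (extension X) (extension X')
  (fun T => twist_map (galpha T) (galpha T) (u (nobj I (gdeg T)))) _ _).
- move=> T g x /=; rewrite gnat_equivariant; congr (gact g _).
  exact: (gnat_gmor u).
- move=> S T f; apply: bmap_eq => x /=.
  exact: (gnat_gmor u).
Defined.

Variable (sIJ : sub_indexing I J).
Local Notation U := (restr_functor sIJ).

Definition ext_unit (X : gamma_functor I) : gamma_nat X (U (extension X)).
Proof.
refine (@GammaNat gT I X (U (extension X)) (fun S =>
  bcomp (to_twist X (galpha S)) (@gmor _ _ X S (nobj I (gdeg S))
    (relabel (galpha S) (trivial_hom gT _)))) _ _).
- move=> S g x /=; rewrite gmor_bcomp [RHS]gact_gmor.
  congr (gmor X _ _); apply: bmap_eq => -[i|] //=.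
  by rewrite perm1 -shomM mulgV shom1.
- move=> S T f; apply: bmap_eq => x /=; rewrite !gmor_bcomp.
  by congr (gmor X _ x); exact: bmap_eq.
Defined.

Definition ext_unit_inv (X : gamma_functor I) : gamma_nat (U (extension X)) X.
Proof.
refine (@GammaNat gT I (U (extension X)) X (fun S =>
  bcomp (@gmor _ _ X (nobj I (gdeg S)) S
    (relabel (trivial_hom gT _) (galpha S))) (of_twist X (galpha S))) _ _).
- move=> S g x /=; rewrite [RHS]gact_gmor bconj_relabel -gmor_bcomp.
  by rewrite (gact_gmor_nobj (X:=X)).
- move=> S T f; apply: bmap_eq => x /=; rewrite !gmor_bcomp.
  by congr (gmor X _ x); exact: bmap_eq.
Defined.

Lemma ext_unitK (X : gamma_functor I) S x :
  ext_unit_inv X S (ext_unit X S x) = x.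
Proof.
rewrite /= gmor_bcomp (_ : bcomp _ _ = bid _) ?gmor_id //; exact: bmap_eq.
Qed.

Lemma ext_unit_invK (X : gamma_functor I) S x :
  ext_unit X S (ext_unit_inv X S x) = x.
Proof.
rewrite /= gmor_bcomp (_ : bcomp _ _ = bid _) ?(gmor_id X (nobj I _)) //.
exact: bmap_eq.
Qed.

End Extension.

Section Counit.
Variables (gT : finGroupType) (I J : indexing_system gT).
Variable (sIJ : sub_indexing I J).
Local Notation U := (restr_functor sIJ).
Local Notation incl := (gamma_incl sIJ).

Definition ext_counit (Y : gamma_functor J) : gamma_nat (extension J (U Y)) Y.
Proof.
refine (@GammaNat gT J (extension J (U Y)) Y (fun T => bcomp
  (@gmor _ _ Y (incl (nobj I (gdeg T))) T
    (relabel (trivial_hom gT _) (galpha T)))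
  (of_twist (U Y) (galpha T))) _ _).
- move=> T g x /=; rewrite [RHS]gact_gmor bconj_relabel.
  by rewrite -(gmor_bcomp (T := incl (nobj I _))) (gact_gmor_nobj (X := U Y)).
- move=> S T f; apply: bmap_eq => x /=; rewrite !gmor_bcomp.
  by congr (gmor Y _ x); exact: bmap_eq.
Defined.

Definition ext_counit_inv (Y : gamma_functor J) :
  gamma_nat Y (extension J (U Y)).
Proof.
refine (@GammaNat gT J Y (extension J (U Y)) (fun T => bcomp
  (to_twist (U Y) (galpha T))
  (@gmor _ _ Y T (incl (nobj I (gdeg T)))
    (relabel (galpha T) (trivial_hom gT _)))) _ _).
- move=> T g x /=.
  rewrite (@gmor_bcomp _ _ Y T (incl (nobj I _)) (incl (nobj I _))).
  rewrite [RHS]gact_gmor; congr (gmor Y _ _); apply: bmap_eq => -[i|] //=.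
  by rewrite perm1 -shomM mulgV shom1.
- move=> S T f; apply: bmap_eq => x /=; rewrite !gmor_bcomp.
  by congr (gmor Y _ x); exact: bmap_eq.
Defined.

Lemma ext_counitK (Y : gamma_functor J) T y :
  ext_counit_inv Y T (ext_counit Y T y) = y.
Proof.
rewrite /= gmor_bcomp (_ : bcomp _ _ = bid _) ?(gmor_id Y (incl (nobj I _))) //.
exact: bmap_eq.
Qed.

Lemma ext_counit_invK (Y : gamma_functor J) T y :
  ext_counit Y T (ext_counit_inv Y T y) = y.
Proof.
by rewrite /= gmor_bcomp (_ : bcomp _ _ = bid _) ?gmor_id //; exact: bmap_eq.
Qed.

End Counit.

(** * Cofibrations *)

Section CofibrationTransfer.
Variable R : realType.

Lemma cofibration_iso (K : finGroupType) (A X A' X' : gspace K)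
    (i : A -> X) (i' : A' -> X') (a : A' -> A) (a' : A -> A')
    (b : X' -> X) (b' : X -> X') :
  continuous a -> continuous a' -> continuous b -> continuous b' ->
  equivariant a -> equivariant a' -> equivariant b -> equivariant b' ->
  cancel a a' -> cancel a' a -> cancel b b' -> (forall x, b (i' x) = i (a x)) ->
  cofibration R i -> cofibration R i'.
Proof.
move=> ca ca' cb cb' ea ea' eb eb' aK aK' bK bi [ci ei hep].
have i'E : i' = b' \o i \o a by apply/funext => x; rewrite /= -bi bK.
have pair (Y Y' T : topologicalType) (c : Y -> Y') (cc : continuous c) :
    continuous (fun p : Y * T => (c p.1, p.2)).
  move=> p; apply: cvg_pair; last exact: cvg_snd.
  by apply: (@continuous_comp _ _ _ fst c); [exact: cvg_fst|exact: cc].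
have kpair (Y Y' : topologicalType) (c : Y -> Y') (cc : continuous c) :
    continuous ((fun p => (c p.1, p.2)) :
      kprod Y (unit_interval R) -> kprod Y' (unit_interval R)).
  exact: kify_continuous (pair _ _ _ _ cc).
split.
- rewrite i'E => x; apply: continuous_comp; first exact: ca.
  by apply: continuous_comp; [exact: ci|exact: cb'].
- by move=> g x; rewrite i'E /= ea ei eb'.
move=> Z f h cf ef [ch eh] h0.
have [||||H [[cH eH] H0 Hi]] := hep Z (f \o b') (fun p => h (a' p.1, p.2)).
- by move=> x; apply: continuous_comp; [exact: cb'|exact: cf].
- by move=> g x; rewrite /= eb' ef.
- split=> [p|g x t /=]; last by rewrite ea' eh.
  exact: (continuous_comp (kpair _ _ _ ca' p) (ch _)).
- by move=> x /=; rewrite h0 i'E /= aK'.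
exists (fun p => H (b p.1, p.2)); split.
- split=> [p|g x t /=]; last by rewrite eb eH.
  exact: (continuous_comp (kpair _ _ _ cb p) (cH _)).
- by move=> x /=; rewrite H0 /= bK.
- by move=> x t /=; rewrite bi Hi /= aK.
Qed.

Lemma cofibrant_iso (gT : finGroupType) (I : indexing_system gT)
    (X Y : gamma_functor I) (u : gamma_nat X Y) (v : gamma_nat Y X) :
  (forall S x, v S (u S x) = x) -> (forall S y, u S (v S y) = y) ->
  cofibrant_injections R X -> cofibrant_injections R Y.
Proof.
move=> uK vK cX m n phi phi_inj.
have eqv (X1 X2 : gamma_functor I) (w : gamma_nat X1 X2) k (S : finGroupType)
    (e : S -> bmap (nplus gT k) (nplus gT k)) e1 eM :
    @equivariant _ (@product_space gT I X1 k (triv_admP I k) S e e1 eM)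
      (@product_space gT I X2 k (triv_admP I k) S e e1 eM) (w (nobj I k)).
  by move=> g x /=; rewrite gnat_equivariant gnat_gmor.
refine (@cofibration_iso _ (phi_source phi_inj X (triv_admP I m))
  (phi_target phi X (triv_admP I n)) (phi_source phi_inj Y (triv_admP I m))
  (phi_target phi Y (triv_admP I n)) _ _ (v (nobj I m)) (u (nobj I m))
  (v (nobj I n)) (u (nobj I n)) _ _ _ _ _ _ _ _ _ _ _ _ (cX m n phi phi_inj)).
all: try exact: bfun_continuous.
all: try exact: eqv.
- exact: vK.
- exact: uK.
- exact: vK.
- by move=> x; rewrite gnat_gmor.
Qed.

End CofibrationTransfer.

(** * The adjoint equivalence *)

Section Category.
Variables (R : realType) (gT : finGroupType).

Lemma gamma_nat_is_iso (I : indexing_system gT) (X Y : gamma_category R I)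
    (u : chom X Y) (v : gamma_nat (Y : gamma_space R I) (X : gamma_space R I)) :
  (forall S x, v S ((u : gamma_nat _ _) S x) = x) ->
  (forall S y, (u : gamma_nat _ _) S (v S y) = y) -> is_iso u.
Proof. by move=> uK vK; exists v; split; apply: gamma_nat_eq. Qed.

Variables (I J : indexing_system gT) (sIJ : sub_indexing I J).

(** The condition only sees the restriction to the objects n_+, which lie in
    Gamma_I, and there [ext_unit] identifies X with its extension. *)
Lemma extension_cofibrant (X : gamma_space R I) :
  cofibrant_injections R (extension J X).
Proof.
have cUX : cofibrant_injections R (restr_functor sIJ (extension J X)).
  exact: (cofibrant_iso (@ext_unitK _ _ _ sIJ X) (@ext_unit_invK _ _ _ sIJ X)
    (gs_cofibrant X)).
move=> m n phi phi_inj; have := cUX m n phi phi_inj.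
rewrite (Prop_irrelevance (triv_admP J m) (sIJ (triv_admP I m))).
by rewrite (Prop_irrelevance (triv_admP J n) (sIJ (triv_admP I n))).
Qed.

Definition extension_functor :
  cfunctor (gamma_category R I) (gamma_category R J).
Proof.
refine (@CFunctor (gamma_category R I) (gamma_category R J)
  (fun X => GammaSpace (extension_cofibrant X))
  (fun X Y u => extension_nat J u) _ _).
- by move=> X; exact: gamma_nat_eq.
- by move=> X Y Z v u; exact: gamma_nat_eq.
Defined.

Definition extension_adjunction :
  adjunction extension_functor (restriction R sIJ).
Proof.
refine (@Adjunction (gamma_category R I) (gamma_category R J)
  extension_functor (restriction R sIJ)
  (fun X => ext_unit sIJ (X : gamma_space R I))
  (fun Y => ext_counit sIJ (Y : gamma_space R J)) _ _ _ _).
- by move=> X Y u; apply: gamma_nat_eq => S x /=; rewrite gnat_gmor.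
- by move=> X Y u; apply: gamma_nat_eq => S x /=; rewrite gnat_gmor.
- move=> X; apply: gamma_nat_eq => T x /=.
  rewrite gmor_bcomp (_ : bcomp _ _ = bid _) ?(gmor_id _ (nobj I _)) //.
  exact: bmap_eq.
- move=> Y; apply: gamma_nat_eq => S y /=.
  rewrite gmor_bcomp (_ : bcomp _ _ = bid _) ?gmor_id //; exact: bmap_eq.
Defined.

Lemma extension_equivalence : adjoint_equivalence extension_adjunction.
Proof.
split=> [X|Y].
  apply: (@gamma_nat_is_iso I _ _ (aunit extension_adjunction X)
    (ext_unit_inv sIJ (X : gamma_space R I))) => S x.
    exact: ext_unitK.
  exact: ext_unit_invK.
apply: (@gamma_nat_is_iso J _ _ (acounit extension_adjunction Y)
  (ext_counit_inv sIJ (Y : gamma_space R J))) => T y.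
  exact: ext_counitK.
exact: ext_counit_invK.
Qed.

End Category.

(** * The coend formula *)

Section LeftKan.
Variables (R : realType) (gT : finGroupType).
Variables (I J : indexing_system gT) (sIJ : sub_indexing I J).
Local Notation incl := (gamma_incl sIJ).

Lemma extension_cowedge (X : gamma_functor I) (T : gamma_obj J) :
  cowedge (sIJ := sIJ) (X := X) (T := T) (Z := extension J X T) (fun S f x =>
    @gmor _ _ (extension J X) (incl S) T f (ext_unit sIJ X S x)).
Proof.
split.
- move=> S.
  apply: (@kprod_continuous (mapsp (gspc (incl S)) (gspc T)) (X S)
    (extension J X T)
    (fun f x => @gmor _ _ (extension J X) (incl S) T f (ext_unit sIJ X S x))).
    by move=> f; exact: alpha_mapsp_open.
  move=> f; exact: (bfun_continuous (b := bcomp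
    (@gmor _ _ (extension J X) (incl S) T f) (ext_unit sIJ X S))).
- by move=> S x; rewrite gmor_zero.
- by move=> S f; rewrite !bfun_base.
- by move=> S g f x; rewrite gnat_equivariant [RHS]gact_gmor.
- move=> S S' e f x; rewrite gnat_gmor.
  by rewrite [RHS](@gmor_bcomp _ _ (extension J X) (incl S) (incl S') T).
Qed.

(** Co-Yoneda: since T_+ is isomorphic to n_+, the functor Gamma_J(-, T_+) on
    Gamma_I is represented by n_+, with universal element [relabel].  The
    comparison map out of X(n_+) is therefore x |-> k(relabel, x), and it is
    equivariant for the twisted action because conjugating [relabel] by g
    composes it with the permutation of n given by g. *)
Lemma extension_is_coend (X : gamma_functor I) (T : gamma_obj J) :
  is_coend (sIJ := sIJ) (X := X) (T := T) (Z := extension J X T) (fun S f x =>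
    @gmor _ _ (extension J X) (incl S) T f (ext_unit sIJ X S x)).
Proof.
split; first exact: extension_cowedge.
move=> Z k [ck kl kr ke kd].
set n := gdeg T; pose r : bmap (gspc (incl (nobj I n))) (gspc T) :=
  relabel (trivial_hom gT n) (galpha T).
pose h0 : X (nobj I n) -> Z := k (nobj I n) r.
have ch0 : continuous h0.
  have cpair : continuous (fun x : X (nobj I n) =>
      (r : mapsp (gspc (incl (nobj I n))) (gspc T), x)).
    move=> x; exact: (@cvg_pair _ _ _ (nbhs x)
      (nbhs (r : mapsp (gspc (incl (nobj I n))) (gspc T))) (nbhs x) _ _ _
      (fun=> r) id (cvg_cst _) cvg_id).
  have {}cpair := continuous_to_kify (gcar_cgwh (X (nobj I n))).1 cpair.
  by move=> x; exact: (continuous_comp (cpair x) (ck _ _)).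
pose h : bmap (extension J X T) Z :=
  @BMap gT (extension J X T) Z h0 ch0 (kr _ _).
exists h; split.
  split=> [g x|S f x].
    rewrite /= -[RHS]ke bconj_relabel.
    rewrite (gact_gmor_nobj (X := X)); apply/esym.
    exact: (kd (nobj I n) (nobj I n) (perm_bmap gT (galpha T g)) r).
  rewrite /= /h0 gmor_bcomp -kd; congr (k S _ x); exact: bmap_eq.
move=> h' [_ h'k]; apply: bmap_eq => x.
rewrite [LHS]/(h0 x) /h0 -h'k; congr (h' _) => /=.
rewrite gmor_bcomp (_ : bcomp _ _ = bid _) ?(gmor_id _ (nobj I _)) //.
exact: bmap_eq.
Qed.

Lemma extension_is_left_kan : is_left_kan (extension_adjunction R sIJ).
Proof. by move=> X T; exact: extension_is_coend. Qed.

End LeftKan.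

Theorem theorem4p38 (R : realType) (gT : finGroupType)
    (I J : indexing_system gT) (sIJ : sub_indexing I J) :
  disk_like I -> disk_like J ->
  (exists (P : cfunctor (gamma_category R I) (gamma_category R J))
      (adj : adjunction P (restriction R sIJ)), is_left_kan adj) /\
  (forall (P : cfunctor (gamma_category R I) (gamma_category R J))
      (adj : adjunction P (restriction R sIJ)),
    is_left_kan adj -> adjoint_equivalence adj).
Proof.
move=> _ _; split=> [|P adj _].
  exists (extension_functor R sIJ), (extension_adjunction R sIJ).
  exact: extension_is_left_kan.
exact: adjoint_equivalence_unique (extension_equivalence R sIJ).
Qed.
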